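(* Let $(M,D)$ be a contact manifold of dimension $2n+1$, let $\theta$ be a local contact form defining $D$, let $(E_1,E_2)$ be a Lagrangian pair on $(M,D)$, and let $\omega,\omega'$ be two bi-decomposable $n$-forms for the Lagrangian pair $(E_1,E_2)$ on $(M,D)$. Assume that they generate the same Monge--Ampère system $$\mathcal M=\langle\theta,d\theta,\omega\rangle=\langle\theta,d\theta,\omega'\rangle .$$ Then there exist locally a non-vanishing function $\mu$ and an $(n-1)$-form $\eta$ on $M$ such that $\omega'=\mu\,\omega+\theta\wedge\eta$.
   Context: All objects are $C^\infty$. A contact structure $D$ on a manifold $M$ of dimension $2n+1$ is a subbundle of $TM$ of codimension one, locally $D=\{\theta=0\}$ for a $1$-form $\theta$ (a contact form) such that $d\theta|_D$ is non-degenerate. This gives a conformal symplectic structure on $D$. A Lagrangian pair $(E_1,E_2)$ is a pair of rank-$n$ subbundles of $D$, each isotropic for $d\theta$, with $D=E_1\oplus E_2$. An $n$-form $\omega$ is bi-decomposable for $(E_1,E_2)$ if $\omega=\omega_1-\omega_2$ for $n$-forms $\omega_1,\omega_2$ satisfying the bi-decomposing condition: $i_u\omega_1=0$ for all $u\in E_2$, $i_v\omega_2=0$ for all $v\in E_1$, $\omega_1|_{E_1}$ is a volume form on $E_1$ (nowhere zero), and $\omega_2|_{E_2}$ is a volume form on $E_2$. $\langle\theta,d\theta,\omega\rangle$ denotes the (algebraic) ideal of exterior differential forms generated by $\theta,d\theta,\omega$; a Monge--Ampère system on $(M,D)$ is an exterior differential system which is locally of this form, with $\theta$ a contact form for $D$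 and $\omega$ an $n$-form. *)

(* Defs.v *)
From mathcomp Require Import all_boot all_order all_algebra.
From mathcomp Require Import all_classical all_reals all_analysis.
Import Order.TTheory GRing.Theory Num.Theory.
Import numFieldNormedType.Exports.

Set Implicit Arguments.
Unset Strict Implicit.
Unset Printing Implicit Defensive.

Local Open Scope classical_set_scope.
Local Open Scope ring_scope.

(* C^infinity on an open set: every iterated directional derivative is
   Frechet differentiable, hence also continuous, at every point. *)
Definition smooth_on (R : realType) (V W : normedModType R) (O : set V)
    (f : V -> W) : Prop :=
  forall vs : seq V, forall x, O x ->
    differentiable (foldr (fun v (g : V -> W) => fun y => 'D_v g y) f vs) x.

Section Manifolds.
Variables (R : realType) (m : nat).
Local Notation V := 'rV[R]_m.

Record chart (M : topologicalType) := Chart {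
  cdom : set M;
  cimg : set V;
  fwd : M -> V;
  bwd : V -> M;
  cdom_open : open cdom;
  cimg_open : open cimg;
  fwd_img : forall p, cdom p -> cimg (fwd p);
  bwd_dom : forall x, cimg x -> cdom (bwd x);
  fwdK : forall p, cdom p -> bwd (fwd p) = p;
  bwdK : forall x, cimg x -> fwd (bwd x) = x;
  fwd_cont : {within cdom, continuous fwd};
  bwd_cont : {within cimg, continuous bwd} }.

(* The field chart_at picks one chart around each point; it only serves to
   represent tangent vectors, see to_chart below. *)
Record smooth_manifold := SmoothManifold {
  carrier :> topologicalType;
  manifold_hausdorff : hausdorff_space carrier;
  manifold_second_countable : @second_countable carrier;
  atlas : set (chart carrier);
  atlas_compatible : forall c c', atlas c -> atlas c' ->
    smooth_on [set x | cimg c x /\ cdom c' (bwd c x)] (fwd c' \o bwd c);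
  chart_at : carrier -> chart carrier;
  chart_at_atlas : forall p, atlas (chart_at p);
  chart_at_dom : forall p, cdom (chart_at p) p }.

Variable M : smooth_manifold.
Implicit Types (p : M) (U : set M) (c : chart M).

(* A vector of T_p M is represented by its coordinates in chart_at p; in any
   other chart its coordinates are given by the differential of the
   transition map. *)
Definition to_chart c p (u : V) : V :=
  'd (fwd c \o bwd (chart_at p)) (fwd (chart_at p) p) u.

Definition of_chart c p (v : V) : V :=
  'd (fwd (chart_at p) \o bwd c) (fwd c p) v.

Definition chart_set c U : set V := [set x | cimg c x /\ U (bwd c x)].

Definition smooth_fun U (f : M -> R) : Prop :=
  forall c, atlas c -> smooth_on (chart_set c U) (f \o bwd c : V -> R^o).

Definition vector_field := M -> V.

Definition smooth_vector_field U (X : vector_field) : Prop :=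
  forall c, atlas c ->
    smooth_on (chart_set c U) (fun x => to_chart c (bwd c x) (X (bwd c x))).

Definition plane_field := M -> {vspace V}.

Definition subbundle (r : nat) (E : plane_field) : Prop :=
  (forall p, \dim (E p) = r) /\
  forall p, exists W : set M, exists X : 'I_r -> vector_field,
    [/\ open W, W p, forall i, smooth_vector_field W (X i)
      & forall q, W q -> E q = <<[seq X i q | i : 'I_r]>>%VS].

(* A differential form, not necessarily homogeneous: its degree k component at p
   is the restriction of alpha p to the lists of k tangent vectors at p. *)
Definition diff_form := M -> seq V -> R.

Definition multilinear (a : seq V -> R) : Prop :=
  forall (s1 s2 : seq V) (t : R) (x y : V),
    a (s1 ++ (t *: x + y) :: s2) = t * a (s1 ++ x :: s2) + a (s1 ++ y :: s2).

Definition alternating (a : seq V -> R) : Prop :=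
  forall (s1 s2 s3 : seq V) (x : V), a (s1 ++ x :: s2 ++ x :: s3) = 0.

Definition form_in_chart c (alpha : diff_form) (x : V) (s : seq V) : R :=
  let p := bwd c x in alpha p (map (of_chart c p) s).

(* alpha restricts to a smooth element of Omega^*(U); its values off U are
   irrelevant. *)
Definition is_form U (alpha : diff_form) : Prop :=
  (forall p, U p -> multilinear (alpha p) /\ alternating (alpha p)) /\
  forall c, atlas c -> forall s : seq V,
    smooth_on (chart_set c U)
      (fun x => form_in_chart c alpha x s : R^o).

Definition is_kform (k : nat) U (alpha : diff_form) : Prop :=
  is_form U alpha /\
  forall p, U p -> forall s, size s != k -> alpha p s = 0.

Fixpoint inversions (b : bitseq) : nat :=
  if b is h :: b' then ((if h then 0 else count id b') + inversions b')%N
  else 0%N.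

(* Shuffle formula: the mask selects the arguments given to alpha. *)
Definition form_wedge (alpha beta : diff_form) : diff_form := fun p s =>
  \sum_(b : (size s).-tuple bool)
    (-1) ^+ inversions b * alpha p (mask b s) * beta p (mask (map negb b) s).

(* Computed at p in chart_at p, on constant coordinate vector fields. *)
Definition extd (alpha : diff_form) : diff_form := fun p s =>
  \sum_(i < size s) (-1) ^+ i *
    'D_(s`_i) (fun x : V => form_in_chart (chart_at p) alpha x
                              (take i s ++ drop i.+1 s) : R^o)
      (fwd (chart_at p) p).

(* The algebraic ideal of Omega^*(U) generated by gs.  The generators are
   meant to be homogeneous, so that by graded commutativity multiplying on
   one side yields the two-sided ideal. *)
Definition form_ideal U (gs : seq diff_form) : set diff_form :=
  [set alpha | is_form U alpha /\
    exists a : nat -> diff_form, (forall i, is_form U (a i)) /\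
      forall p, U p -> forall s,
        alpha p s =
          \sum_(i < size gs) form_wedge (nth (fun _ _ => 0) gs i) (a i) p s].

Definition contact_form (D : plane_field) U (theta : diff_form) : Prop :=
  is_kform 1 U theta /\
  forall p, U p ->
    (forall u : V, u \in D p <-> theta p [:: u] = 0) /\
    (forall u, u \in D p ->
       (forall v, v \in D p -> extd theta p [:: u; v] = 0) -> u = 0).

Definition contact_structure (n : nat) (D : plane_field) : Prop :=
  subbundle (2 * n) D /\
  forall p, exists U : set M, exists theta,
    [/\ open U, U p & contact_form D U theta].

Definition isotropic (D E : plane_field) : Prop :=
  forall (U : set M) theta, open U -> contact_form D U theta ->
    forall p, U p -> forall u v, u \in E p -> v \in E p ->
      extd theta p [:: u; v] = 0.

Definition lagrangian_pair (n : nat) (D E1 E2 : plane_field) : Prop :=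
  [/\ subbundle n E1, subbundle n E2, isotropic D E1, isotropic D E2
    & forall p, (E1 p + E2 p = D p)%VS /\ (E1 p :&: E2 p = 0)%VS].

Definition bidecomposing (n : nat) (E1 E2 : plane_field)
    (omega1 omega2 : diff_form) : Prop :=
  [/\ is_kform n setT omega1, is_kform n setT omega2,
      forall p u s, u \in E2 p -> omega1 p (u :: s) = 0,
      forall p v s, v \in E1 p -> omega2 p (v :: s) = 0
    & forall p,
       (exists2 s : seq V, all (fun u => u \in E1 p) s & omega1 p s != 0) /\
       (exists2 s : seq V, all (fun u => u \in E2 p) s & omega2 p s != 0)].

Definition bidecomposable (n : nat) (E1 E2 : plane_field) (omega : diff_form)
    : Prop :=
  exists omega1 omega2, bidecomposing n E1 E2 omega1 omega2 /\
    forall p s, omega p s = omega1 p s - omega2 p s.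

Definition monge_ampere U (theta omega : diff_form) : set diff_form :=
  form_ideal U [:: theta; extd theta; omega].

End Manifolds.

(* Main.v *)
(** On [D], write [omega = omega1 - omega2] and [omega' = omega1' - omega2'].
    Membership of [omega'] in the ideal of [omega] gives
    [omega' = mu omega + theta /\ b + dtheta /\ c] with [mu] a smooth function.
    On arguments taken in [E1], both [theta] and [dtheta] vanish because [E1] is
    isotropic, and [omega], [omega'] reduce to [omega1], [omega1'], so
    [omega1' = mu omega1] there; likewise [omega2' = mu omega2] on [E2].  Projecting
    along the other factor extends both equalities to [D], so that
    [sigma = omega' - mu omega] vanishes on [D], and [mu] has no zero because
    [omega1'] is a volume form on [E1].  Finally, for a local vector field [T] with
    [theta T = 1], [sigma = theta /\ i_T sigma]. *)
Require Import Defs.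
From mathcomp Require Import all_boot all_order all_algebra.
From mathcomp Require Import all_classical all_reals all_analysis.
From mathcomp Require Import ring.
Import Order.TTheory GRing.Theory Num.Theory.
Import numFieldNormedType.Exports.
Local Open Scope classical_set_scope.
Local Open Scope ring_scope.

(** * Smooth functions *)

(** Equal germs have the same first-order expansion at [x], and the differential is the unique
    linear part of that expansion. *)
Lemma near_eq_diff (R : realType) (V W : normedModType R) (f g : V -> W) (x : V) :
  (\near x, f x = g x) -> differentiable f x ->
  differentiable g x /\ 'd g x = 'd f x :> (V -> W).
Proof.
move=> fg /diff_locallyP[df fE].
have gE : g \o shift x = cst (g x) + 'd f x +o_ 0 id.
  rewrite -(nbhs_singleton fg); apply/eqaddoP => e e0.
  have /eqaddoP/(_ e e0) := fE.
  have : \forall h \near 0, f (h + x) = g (h + x).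
    by move: fg; rewrite (near_shift 0) subr0.
  apply: filterS2 => h E; rewrite !fctE /= E; exact.
have dgE : 'd g x = 'd f x :> (V -> W) by apply: diff_unique.
split; last exact: dgE.
apply/diff_locallyP; rewrite dgE; split; [exact: df|exact: gE].
Qed.

(* [Ck 0] is differentiability rather than continuity: only the conjunction over
   all [k] matters, and differentiability is what the rules for derivatives need. *)
Fixpoint Ck {R : realType} {V W : normedModType R} (k : nat) (O : set V)
    (f : V -> W) : Prop :=
  (forall x, O x -> differentiable f x) /\
  (if k is k'.+1 then forall v, Ck k' O (fun y => 'D_v f y) else True).

Section Ck.
Context {R : realType} {V : normedModType R}.
Implicit Types (W : normedModType R) (O : set V) (k : nat).

Lemma Ck_diff {W} k O (f : V -> W) : Ck k O f -> forall x, O x -> differentiable f x.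
Proof. by case: k => [|k] []. Qed.

(** [Ck] turns smoothness into a statement provable by induction on the order, which the closure
    rules below rely on. *)
Lemma smooth_onP {W} O (f : V -> W) : smooth_on O f <-> forall k, Ck k O f.
Proof.
split=> [fO k|fO vs].
  elim: k f fO => [|k IH] f fO; (split; first exact: (fO [::])) => // v.
  by apply: IH => vs x Ox; have := fO (rcons vs v) x Ox; rewrite foldr_rcons.
(* [foldr] differentiates along the last vector first, and [Ck] peels off this innermost derivative,
   so the list is consumed from its end. *)
elim/last_ind: vs f fO => [|vs v IH] f fO x Ox; first exact: Ck_diff (fO 0%N) x Ox.
rewrite foldr_rcons; apply: IH => // k; by have [_] := fO k.+1; apply.
Qed.

Lemma CkW {W} k O (f : V -> W) : Ck k.+1 O f -> Ck k O f.
Proof.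
elim: k f => [|k IH] f [df Df]; split=> // v; exact/IH/Df.
Qed.

(** As [O] is open, equality on [O] is equality of germs at its points, so all derivatives agree.
    This lets a derivative be replaced by an explicit formula for it. *)
Lemma eq_Ck {W} k O (f g : V -> W) : open O -> (forall x, O x -> f x = g x) ->
  Ck k O f -> Ck k O g.
Proof.
move=> oO; elim: k f g => [|k IH] f g fg /=.
  move=> [df _]; split=> // x Ox.
  apply: (proj1 (near_eq_diff _ _ _ f g x _ (df x Ox))).
  by apply: filterS (open_nbhs_nbhs (conj oO Ox)) => y /fg.
move=> [df Df].
have dg x (Ox : O x) : differentiable g x /\ 'd g x = 'd f x :> (V -> W).
  apply: near_eq_diff (df x Ox).
  by apply: filterS (open_nbhs_nbhs (conj oO Ox)) => y /fg.
split=> [x /dg[]//|v]; apply: IH (Df v) => x Ox.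
have [dgx E] := dg x Ox; rewrite [LHS]deriveE; last exact: df.
rewrite [RHS]deriveE; last exact: dgx.
exact: (esym (congr1 (@^~ v) E)).
Qed.

Lemma Ck_cst {W} k O (a : W) : open O -> Ck k O (fun _ : V => a).
Proof.
move=> oO; elim: k a => [|k IH] a; split=> // v.
by apply: eq_Ck (IH 0) => // x _; rewrite derive_cst.
Qed.

Lemma CkD {W} k O (f g : V -> W) : open O -> Ck k O f -> Ck k O g ->
  Ck k O (fun x => f x + g x).
Proof.
move=> oO; elim: k f g => [|k IH] f g [df Df] [dg Dg]; split=> //.
- by move=> x Ox; apply: differentiableD; [apply: df|apply: dg].
- by move=> x Ox; apply: differentiableD; [apply: df|apply: dg].
move=> v; apply: eq_Ck (IH _ _ (Df v) (Dg v)) => // x Ox.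
by rewrite deriveD//; apply: diff_derivable; [apply: df|apply: dg].
Qed.

Lemma Ck_sum {W} (I : Type) (r : seq I) k O (f : I -> V -> W) : open O ->
  (forall i, Ck k O (f i)) -> Ck k O (fun x => \sum_(i <- r) f i x).
Proof.
move=> oO Cf; elim: r => [|i r IH].
  by apply: eq_Ck (Ck_cst k O 0 oO) => // x _; rewrite big_nil.
by apply: eq_Ck (CkD k O _ _ oO (Cf i) IH) => // x _; rewrite big_cons.
Qed.

Lemma CkM k O (f g : V -> R^o) : open O -> Ck k O f -> Ck k O g ->
  Ck k O (fun x => f x * g x : R^o).
Proof.
move=> oO; elim: k f g => [|k IH] f g Cf Cg; have [df Df] := Cf; have [dg Dg] := Cg.
  split=> // x Ox; exact: (@differentiableM R V f g x (df x Ox) (dg x Ox)).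
split=> [x Ox|v].
  exact: (@differentiableM R V f g x (df x Ox) (dg x Ox)).
have CfDg := IH _ _ (CkW _ _ _ Cf) (Dg v); have CgDf := IH _ _ (CkW _ _ _ Cg) (Df v).
apply: eq_Ck (CkD k O _ _ oO CfDg CgDf) => // x Ox /=.
by rewrite (@deriveM R V f g)//; apply: diff_derivable; [apply: df|apply: dg].
Qed.

Lemma CkN k O (f : V -> R^o) : open O -> Ck k O f -> Ck k O (fun x => - f x).
Proof.
move=> oO Cf; apply: eq_Ck (CkM k O _ _ oO (Ck_cst k O (-1 : R^o) oO) Cf) => // x _.
by rewrite mulN1r.
Qed.

(** The derivative is [- f^-2 * 'D_v f]. It contains the inverse of [f] again, so the induction on
    [k] keeps [f] fixed. *)
Lemma CkV k O (f : V -> R^o) : open O -> (forall x, O x -> f x != 0) ->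
  Ck k O f -> Ck k O (fun x => (f x)^-1 : R^o).
Proof.
move=> oO f0; elim: k => [|k IH] Cf; have [df Df] := Cf.
  split=> // x Ox; exact: (@differentiableV R V f x (df x Ox) (f0 x Ox)).
split=> [x Ox|v].
  exact: (@differentiableV R V f x (df x Ox) (f0 x Ox)).
have Cfi := IH (CkW _ _ _ Cf).
apply: eq_Ck (CkN k O _ oO (CkM k O _ _ oO (CkM k O _ _ oO Cfi Cfi) (Df v))) => // x Ox.
rewrite (@deriveV R V f) ?f0//; last by apply: diff_derivable; apply: df.
by rewrite scaleNr -invfM -expr2.
Qed.

End Ck.

(** * Maps into row vectors and the chain rule *)

Section CkrV.
Context {R : realType}.

Lemma Ck_coord (V : normedModType R) m k (O : set V) (f : V -> 'rV[R]_m) j :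
  open O -> Ck k O f -> Ck k O (fun x => f x ord0 j : R^o).
Proof.
move=> oO; elim: k f => [|k IH] f [df Df].
  split=> // x Ox.
  exact: (differentiable_comp (df x Ox) (differentiable_coord (f x) ord0 j)).
have dfj x (Ox : O x) :=
  differentiable_comp (df x Ox) (differentiable_coord (f x) ord0 j).
split=> // v; apply: eq_Ck (IH _ (Df v)) => // x Ox /=.
by rewrite derive_mx ?mxE//; apply: diff_derivable; apply: df.
Qed.

Lemma CkZl (V W : normedModType R) k (O : set V) (h : V -> R^o) (w : W) :
  open O -> Ck k O h -> Ck k O (fun x => h x *: w).
Proof.
move=> oO; elim: k h => [|k IH] h [dh Dh].
  by split=> // x Ox; apply: differentiableZl; apply: dh.
split=> [x Ox|v]; first by apply: differentiableZl; apply: dh.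
apply: eq_Ck (IH _ (Dh v)) => // x Ox.
rewrite [RHS]deriveE; last by apply: differentiableZl; apply: dh.
by rewrite diffZl -?deriveE//; apply: dh.
Qed.

Lemma Ck_rV (V : normedModType R) m k (O : set V) (f : V -> 'rV[R]_m) :
  open O -> (forall j, Ck k O (fun x => f x ord0 j : R^o)) -> Ck k O f.
Proof.
move=> oO Cf.
apply: (eq_Ck _ _ (fun x => \sum_j f x ord0 j *: 'e_j)) => //.
  by move=> x _; rewrite -row_sum_delta.
by apply: Ck_sum => // j; apply: CkZl.
Qed.

Lemma diff_rV_sum m (W : normedModType R) (f : 'rV[R]_m -> W) x u :
  differentiable f x -> 'd f x u = \sum_j u ord0 j *: 'D_('e_j) f x.
Proof.
move=> df; rewrite {1}(row_sum_delta u) linear_sum; apply: eq_bigr => j _.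
by rewrite linearZ deriveE.
Qed.

(** In coordinates the chain rule writes a derivative of [g \o f] as a sum of products of components
    of ['D_v f] with partial derivatives of [g] composed with [f]; induction applies to the
    latter. *)
Lemma Ck_comp m (V : normedModType R) k (O : set V) (O' : set 'rV[R]_m)
    (f : V -> 'rV[R]_m) (g : 'rV[R]_m -> R^o) :
  open O -> open O' -> (forall x, O x -> O' (f x)) ->
  Ck k O f -> Ck k O' g -> Ck k O (g \o f).
Proof.
move=> oO oO' fO; elim: k g => [|k IH] g Cf Cg; have [df Df] := Cf; have [dg Dg] := Cg.
  by split=> // x Ox; apply: differentiable_comp; [apply: df|apply/dg/fO].
split=> [x Ox|v].
  by apply: differentiable_comp; [apply: df|apply/dg/fO].
apply: (eq_Ck _ _ (fun x => \sum_j ('D_v f x) ord0 j * ('D_('e_j) g \o f) x : R^o)) => //.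
  move=> x Ox; have dfx := df x Ox; have dgx := dg _ (fO x Ox).
  rewrite [RHS]deriveE; last exact: differentiable_comp.
  by rewrite diff_comp//= diff_rV_sum// -deriveE.
apply: Ck_sum => // j; apply: CkM => //.
  exact: Ck_coord (Df v).
exact: (IH _ (CkW _ _ _ Cf) (Dg 'e_j)).
Qed.

End CkrV.

(** * Alternating multilinear functions *)

Section Multilinear.
Context {R : realType} {m : nat}.
Local Notation V := 'rV[R]_m.
Implicit Types (a b : seq V -> R) (s : seq V) (u x y T : V).

Lemma multilinearD a : multilinear a -> forall s1 s2 x y,
  a (s1 ++ (x + y) :: s2) = a (s1 ++ x :: s2) + a (s1 ++ y :: s2).
Proof. by move=> al s1 s2 x y; have := al s1 s2 1 x y; rewrite scale1r mul1r. Qed.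

Lemma multilinear0 a : multilinear a -> forall s1 s2, a (s1 ++ 0 :: s2) = 0.
Proof.
move=> al s1 s2; have := multilinearD a al s1 s2 0 0.
by rewrite addr0 => /eqP; rewrite -subr_eq subrr => /eqP <-.
Qed.

Lemma multilinearZ a : multilinear a -> forall s1 s2 t x,
  a (s1 ++ t *: x :: s2) = t * a (s1 ++ x :: s2).
Proof.
by move=> al s1 s2 t x; have := al s1 s2 t x 0; rewrite addr0 multilinear0// addr0.
Qed.

Lemma multilinear_sum a : multilinear a ->
  forall (I : Type) (r : seq I) (t : I -> R) (x : I -> V) s1 s2,
  a (s1 ++ (\sum_(i <- r) t i *: x i) :: s2) =
  \sum_(i <- r) t i * a (s1 ++ x i :: s2).
Proof.
move=> al I r t x s1 s2; elim: r => [|i r IH]; first by rewrite !big_nil multilinear0.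
by rewrite !big_cons al IH.
Qed.

(* Unqualified, [alternating] is MathComp's predicate on bilinear forms. *)
Lemma alternating_swap a : multilinear a -> Defs.alternating a ->
  forall s1 s2 s3 x y, a (s1 ++ x :: s2 ++ y :: s3) = - a (s1 ++ y :: s2 ++ x :: s3).
Proof.
move=> al aa s1 s2 s3 x y; have := aa s1 s2 s3 (x + y).
have D z : a (s1 ++ z :: s2 ++ (x + y) :: s3) =
    a (s1 ++ z :: s2 ++ x :: s3) + a (s1 ++ z :: s2 ++ y :: s3).
  by rewrite -!(cat_cons z) !catA multilinearD.
by rewrite multilinearD// !D !aa add0r addr0 => /addr0_eq <-; rewrite opprK.
Qed.

(** The interior product $i_u a$. *)
Definition insertion u a : seq V -> R := fun s => a (u :: s).

Lemma multilinear_insertion u a : multilinear a -> multilinear (insertion u a).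
Proof. by move=> al s1 s2 t x y; apply: (al (u :: s1)). Qed.

Lemma alternating_insertion u a : Defs.alternating a -> Defs.alternating (insertion u a).
Proof. by move=> aa s1 s2 s3 x; apply: (aa (u :: s1)). Qed.

Lemma multilinearBZ a b (t : R) : multilinear a -> multilinear b ->
  multilinear (fun s => a s - t * b s).
Proof. by move=> al bl s1 s2 r x y; rewrite al bl; ring. Qed.

Lemma alternatingBZ a b (t : R) : Defs.alternating a -> Defs.alternating b ->
  Defs.alternating (fun s => a s - t * b s).
Proof. by move=> aa ba s1 s2 s3 x; rewrite aa ba mulr0 subr0. Qed.

(** Vectors of [K] may be subtracted from the arguments one slot at a time. It is applied with [f] a
    projection and [K] containing the vectors that the projection removes. *)
Lemma alternating_map_mod a (K : V -> Prop) (f : V -> V) s :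
  multilinear a -> Defs.alternating a -> (forall u s', K u -> a (u :: s') = 0) ->
  {in s, forall u, K (u - f u)} -> a (map f s) = a s.
Proof.
move=> al aa aK Kf.
(* A vector of [K] in any slot can be exchanged with the first argument. *)
have aK' u s1 s2 : K u -> a (s1 ++ u :: s2) = 0.
  case: s1 => [|x s1] Ku; first exact: aK.
  by rewrite cat_cons (alternating_swap a al aa [::]) aK// oppr0.
(* The prefix [s1] holds the slots already treated. *)
suff E : forall s1, a (s1 ++ map f s) = a (s1 ++ s) by exact: (E [::]).
elim: s Kf => [//|u s IH] Kf s1 /=.
have <- : a (s1 ++ f u :: s) = a (s1 ++ u :: s).
  rewrite -[u in RHS](subrK (f u)) multilinearD// (aK' (u - f u)) ?add0r//.
  by apply: Kf; rewrite mem_head.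
rewrite -!cat_rcons; apply: IH => v vs; apply: Kf; exact: mem_behead.
Qed.

(** * Shuffle products *)

(* [form_wedge alpha beta p s] is convertible to [wedge (alpha p) (beta p) s]. *)
Definition wedge a b s : R :=
  \sum_(c : (size s).-tuple bool)
    (-1) ^+ inversions c * a (mask c s) * b (mask (map negb c) s).

Lemma wedge_nil a b : wedge a b [::] = a [::] * b [::].
Proof.
rewrite /wedge /= (big_pred1 [tuple]); last by move=> c; apply/esym/eqP; exact: tuple0.
by rewrite /= expr0 mul1r.
Qed.

Lemma big_tuple_cons n (F : bool -> n.-tuple bool -> R) :
  \sum_(c : n.+1.-tuple bool) F (thead c) (behead_tuple c) =
  \sum_c F true c + \sum_c F false c.
Proof.
pose h (p : bool * n.-tuple bool) := [tuple of p.1 :: p.2].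
rewrite (reindex h) /=; last first.
  exists (fun c => (thead c, behead_tuple c)) => [[x c] _|c _].
    by rewrite /h theadE; congr (_, _); apply: val_inj.
  by rewrite /h /= [RHS]tuple_eta; apply: val_inj.
rewrite (eq_bigr (fun p => F p.1 p.2)); last first.
  by move=> [x c] _ /=; rewrite /h theadE; congr F; apply: val_inj.
by rewrite -(pair_bigA _ F) /= big_bool.
Qed.

(** The shuffles are sorted by the factor that receives [u]. When it is [b], every argument given to
    [a] has to pass [u], which accounts for the extra [count id c] inversions. *)
Lemma wedge_cons a b u s : wedge a b (u :: s) =
  wedge (insertion u a) b s +
  \sum_(c : (size s).-tuple bool) (-1) ^+ (count id c + inversions c) *
    a (mask c s) * b (u :: mask (map negb c) s).
Proof.
pose F (x : bool) (c : (size s).-tuple bool) : R :=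
  (-1) ^+ inversions (x :: c) * a (mask (x :: c) (u :: s)) *
  b (mask (map negb (x :: c)) (u :: s)).
rewrite /wedge /= -[RHS](big_tuple_cons _ F); apply: eq_bigr => c _.
case/tupleP: c => x c; rewrite /F theadE.
by congr (_ ^+ inversions (_ :: _) * a (mask (_ :: _) _) * _).
Qed.

Lemma eq_wedge a a' b b' s : a =1 a' -> b =1 b' -> wedge a b s = wedge a' b' s.
Proof. by move=> E E'; apply: eq_bigr => c _; rewrite E E'. Qed.

Lemma wedge0l a b s : (forall c, a (mask c s) = 0) -> wedge a b s = 0.
Proof. by move=> a0; rewrite /wedge big1// => c _; rewrite a0 mulr0 mul0r. Qed.

Lemma wedgeNr a b s : wedge a (fun s => - b s) s = - wedge a b s.
Proof. by rewrite /wedge -sumrN; apply: eq_bigr => c _; rewrite mulrN. Qed.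

Lemma wedge_scalar a b s : (forall l : seq V, l != [::] -> a l = 0) ->
  wedge a b s = a [::] * b s.
Proof.
elim: s b => [|u s IH] b a0; first by rewrite wedge_nil.
rewrite wedge_cons wedge0l ?add0r; last by move=> c; apply: a0.
have := IH (insertion u b) a0; rewrite /insertion => <-; apply: eq_bigr => c _.
case: (eqVneq (mask c s) [::]) => [E|/a0->]; last by rewrite !mulr0 !mul0r.
by rewrite -(size_mask (size_tuple c)) E.
Qed.

(** Only the shuffle giving every argument to [a] survives, so a possibly inhomogeneous [b]
    contributes just its degree 0 part. *)
Lemma wedge_scalar_r k a b s : (forall l : seq V, size l != k -> a l = 0) ->
  size s = k -> wedge a b s = a s * b [::].
Proof.
move=> ak; elim: s k a ak => [|u s IH] k a ak sk; first by rewrite wedge_nil.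
rewrite wedge_cons big1 ?addr0; last first.
  move=> c _; rewrite ak ?mulr0 ?mul0r// size_mask ?size_tuple// -sk neq_ltn.
  by rewrite ltnS -[leqRHS](size_tuple c) count_size.
by rewrite (IH (size s))// => x xs; rewrite /insertion ak// -sk /= eqSS.
Qed.

(** This is the antiderivation rule for $i_u$ on the product of a 1-form with [b]; the sign comes
    from the single argument of [th] that passes [u]. *)
Lemma wedge_1form_cons th b u s : (forall l : seq V, size l != 1%N -> th l = 0) ->
  wedge th b (u :: s) = th [:: u] * b s - wedge th (insertion u b) s.
Proof.
move=> th1; rewrite wedge_cons wedge_scalar; last first.
  by move=> [|y x] // _; rewrite /insertion th1.
congr (_ + _); rewrite -wedgeNr; apply: eq_bigr => c _.
case: (eqVneq (size (mask c s)) 1%N) => [E|/th1->]; last by rewrite !mulr0 !mul0r.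
move: E; rewrite size_mask ?size_tuple// => ->.
by rewrite exprD expr1 !mulN1r mulrN !mulNr.
Qed.

Lemma wedge_size (k l : nat) a b s : (forall l : seq V, size l != k -> a l = 0) ->
  (forall x : seq V, size x != l -> b x = 0) -> size s != (k + l)%N -> wedge a b s = 0.
Proof.
move=> ak bl skl; rewrite /wedge big1// => c _.
case: (eqVneq (size (mask c s)) k) => [Ek|/ak->]; last by rewrite mulr0 mul0r.
case: (eqVneq (size (mask (map negb c) s)) l) => [El|/bl->]; last by rewrite mulr0.
move: skl; rewrite -Ek -El !size_mask ?size_map ?size_tuple// count_map.
by rewrite (count_predC id) size_tuple eqxx.
Qed.

(* The formula [th /\ i_T a = a - i_T (th /\ a)], with the last term written as the
   pullback of [a] by the projection onto the kernel of [th] along [T]. *)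
Lemma wedge_1form_insertion th T a s : multilinear a -> Defs.alternating a ->
  (forall l : seq V, size l != 1%N -> th l = 0) -> th [:: T] = 1 ->
  wedge th (insertion T a) s =
  a s - a [seq u - th [:: u] *: T | u <- s].
Proof.
move=> al aa th1 thT; elim: s a al aa => [|u s IH] a al aa.
  by rewrite wedge_nil th1 // mul0r /= subrr.
rewrite wedge_1form_cons //.
(* Interior products anticommute, which brings the induction hypothesis to bear on
   [insertion u a]. *)
have swap (x : seq V) : insertion u (insertion T a) x = - insertion T (insertion u a) x.
  exact: (alternating_swap a al aa [::] [::]).
rewrite (eq_wedge _ th _ _ s (fun=> erefl) swap) wedgeNr opprK.
rewrite IH; [|exact: multilinear_insertion|exact: alternating_insertion].
set f := fun u : V => u - _; rewrite /= -/(f u) /insertion.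
(* Once [T] is an argument, multiples of [T] in the other slots contribute nothing, so projecting
   those slots is harmless. *)
have <- : a (T :: map f s) = a (T :: s).
  apply: (alternating_map_mod (insertion T a) (fun v => exists t, v = t *: T)).
  - exact: multilinear_insertion.
  - exact: alternating_insertion.
  - by move=> _ x [t ->]; rewrite /insertion (multilinearZ a al [:: T])
      (aa [::] [::]) mulr0.
  - by move=> v _; exists (th [:: v]); rewrite /f opprB addrCA subrr addr0.
have -> : a (f u :: map f s) = a (u :: map f s) - th [:: u] * a (T :: map f s).
  by rewrite /f -scaleNr addrC (al [::]) /= mulNr addrC.
ring.
Qed.

End Multilinear.

(** * Forms on a manifold *)

Section ManifoldForms.
Context {R : realType} {m : nat} {M : smooth_manifold R m}.
Local Notation V := 'rV[R]_m.
Implicit Types (U W : set M) (c : chart R m M) (q : M).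

Lemma open_chart_set c U : open U -> open (chart_set c U).
Proof.
move=> oU; rewrite openE => x [cx Ux].
have oc : open (cimg c) by exact: cimg_open.
have cb : {for x, continuous (bwd c)}.
  by have := @bwd_cont _ _ _ c; rewrite continuous_open_subspace//; apply; rewrite inE.
have : nbhs x (bwd c @^-1` U) by apply: cb; apply: open_nbhs_nbhs.
by apply: filterS2 (open_nbhs_nbhs (conj oc cx)) => y.
Qed.

Lemma fwd_continuous c q : cdom c q -> {for q, continuous (fwd c)}.
Proof.
move=> cq; have := @fwd_cont _ _ _ c.
by rewrite continuous_open_subspace; [apply; rewrite inE|exact: cdom_open].
Qed.

Lemma chart_set_fwd c U q : cdom c q -> U q -> chart_set c U (fwd c q).
Proof. by move=> cq Uq; split; [exact: fwd_img|rewrite fwdK]. Qed.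

Lemma near_chart c U q : open U -> cdom c q -> U q ->
  \forall x \near fwd c q, chart_set c U x.
Proof.
move=> oU cq Uq; apply: open_nbhs_nbhs.
by split; [exact: open_chart_set|exact: chart_set_fwd].
Qed.

Lemma transition_diff c c' q : atlas c -> atlas c' -> cdom c q -> cdom c' q ->
  differentiable (fwd c' \o bwd c) (fwd c q).
Proof.
by move=> ac ac' cq c'q; apply: (atlas_compatible ac ac' [::]); exact: chart_set_fwd.
Qed.

(** The chain rule for transition maps: the composite through [c2] equals the direct transition only
    near the point, which suffices for differentials. *)
Lemma diff_transition_comp c1 c2 c3 q u : atlas c1 -> atlas c2 -> atlas c3 ->
  cdom c1 q -> cdom c2 q -> cdom c3 q ->
  'd (fwd c3 \o bwd c2) (fwd c2 q) ('d (fwd c2 \o bwd c1) (fwd c1 q) u) =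
  'd (fwd c3 \o bwd c1) (fwd c1 q) u.
Proof.
move=> a1 a2 a3 q1 q2 q3.
have E2 : (fwd c2 \o bwd c1) (fwd c1 q) = fwd c2 q by rewrite /= fwdK.
have d21 : differentiable (fwd c2 \o bwd c1) (fwd c1 q) by exact: transition_diff.
have d32 : differentiable (fwd c3 \o bwd c2) ((fwd c2 \o bwd c1) (fwd c1 q)).
  by rewrite E2; exact: transition_diff.
have C := congr1 (fun f : V -> V => f u) (diff_comp d21 d32).
rewrite E2 in C.
have [|_ E] := near_eq_diff _ _ _ _ (fwd c3 \o bwd c1) _ _ (differentiable_comp d21 d32).
  apply: filterS (near_chart c1 _ q (@cdom_open _ _ _ c2) q1 q2) => x [_ bx].
  by rewrite /= fwdK.
exact: (etrans (esym C) (esym (congr1 (fun f : V -> V => f u) E))).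
Qed.

Lemma diff_transition_id c q u : cdom c q -> 'd (fwd c \o bwd c) (fwd c q) u = u.
Proof.
move=> cq; have did : is_diff (fwd c q) (id : V -> V) id by exact: is_diff_id.
have [|_ E] :=
  near_eq_diff _ _ _ id (fwd c \o bwd c) (fwd c q) _ (@ex_diff _ _ _ _ _ _ _ did).
  apply: filterS (near_chart c _ q (@cdom_open _ _ _ c) cq cq) => x [cx _].
  by rewrite /= bwdK.
exact: (congr1 (fun f : V -> V => f u) (etrans E (@diff_val _ _ _ _ _ _ _ did))).
Qed.

Lemma of_chartK c q u : atlas c -> cdom c q -> of_chart c q (to_chart c q u) = u.
Proof.
move=> ac cq; rewrite /of_chart /to_chart diff_transition_comp ?diff_transition_id//;
  by [exact: chart_at_atlas|exact: chart_at_dom].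
Qed.

(** * Smooth functions, vector fields and forms on open sets *)

Lemma smooth_fun_sub U W (f : M -> R) : W `<=` U -> smooth_fun U f -> smooth_fun W f.
Proof. by move=> WU sf c ac vs x [cx Wx]; apply: sf => //; split=> //; exact: WU. Qed.

Lemma smooth_vector_field_sub U W (X : vector_field M) : W `<=` U ->
  smooth_vector_field U X -> smooth_vector_field W X.
Proof. by move=> WU sf c ac vs x [cx Wx]; apply: sf => //; split=> //; exact: WU. Qed.

Lemma is_form_sub U W (a : diff_form M) : W `<=` U -> is_form U a -> is_form W a.
Proof.
move=> WU [am sa]; split=> [p /WU/am//|c ac s vs x [cx Wx]].
by apply: sa => //; split=> //; exact: WU.
Qed.

Lemma is_kform_sub k U W (a : diff_form M) : W `<=` U -> is_kform k U a -> is_kform k W a.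
Proof. by move=> WU [fa ka]; split; [exact: is_form_sub fa|move=> p /WU/ka]. Qed.

Lemma smooth_funP U (f : M -> R) : smooth_fun U f <->
  forall c, atlas c -> forall k, Ck k (chart_set c U) (f \o bwd c : V -> R^o).
Proof. by split=> sf c ac; apply/smooth_onP; exact: sf. Qed.

Lemma is_form_subZ U (f : M -> R) (a b : diff_form M) : open U ->
  smooth_fun U f -> is_form U a -> is_form U b ->
  is_form U (fun q s => a q s - f q * b q s).
Proof.
move=> oU sf [am sa] [bm sb]; split=> [p Up|c ac s].
  have [? ?] := am p Up; have [? ?] := bm p Up.
  by split; [exact: multilinearBZ|exact: alternatingBZ].
have oc : open (chart_set c U) by exact: open_chart_set.
apply/smooth_onP => k; apply: CkD => //; first by have /smooth_onP := sa c ac s; apply.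
apply: CkN => //; apply: CkM => //; first by have /smooth_onP := sf c ac; apply.
by have /smooth_onP := sb c ac s; apply.
Qed.

Lemma is_form_insertion U (X : vector_field M) (a : diff_form M) : open U ->
  smooth_vector_field U X -> is_form U a ->
  is_form U (fun q => insertion (X q) (a q)).
Proof.
move=> oU sX [am sa]; split=> [p Up|c ac s].
  have [? ?] := am p Up.
  by split; [exact: multilinear_insertion|exact: alternating_insertion].
have oc : open (chart_set c U) by exact: open_chart_set.
pose Y x := to_chart c (bwd c x) (X (bwd c x)).
apply/smooth_onP => k.
(* Expanding [X] in the coordinate fields of [c], with components [Y], gives a sum of products of
   smooth functions. *)
apply: (eq_Ck _ _ (fun x => \sum_j Y x ord0 j * form_in_chart c a x ('e_j :: s) : R^o)) => //.
  move=> x [cx Ux]; have dx := bwd_dom cx; have [aml _] := am _ Ux.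
  rewrite /form_in_chart /insertion -[X in a _ (X :: _)](of_chartK c (bwd c x))//.
  rewrite -/(Y x) [X in of_chart _ _ X]row_sum_delta /of_chart linear_sum.
  rewrite (eq_bigr (fun j => Y x ord0 j *: of_chart c (bwd c x) 'e_j)); last first.
    by move=> j _; rewrite linearZ.
  by rewrite (multilinear_sum _ aml _ _ _ _ [::]).
apply: Ck_sum => // j; apply: CkM => //.
  by apply: Ck_coord => //; have /smooth_onP := sX c ac; apply.
by have /smooth_onP := sa c ac ('e_j :: s); apply.
Qed.

Lemma is_kform_insertion U k (X : vector_field M) (a : diff_form M) : open U ->
  smooth_vector_field U X -> is_kform k.+1 U a ->
  is_kform k U (fun q => insertion (X q) (a q)).
Proof.
move=> oU sX [fa ka]; split; first exact: is_form_insertion.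
by move=> p Up s sk; apply: ka => //=; rewrite eqSS.
Qed.

Lemma smooth_contraction U (X : vector_field M) (a : diff_form M) : open U ->
  smooth_vector_field U X -> is_form U a -> smooth_fun U (fun q => a q [:: X q]).
Proof.
move=> oU sX fa c ac; have [_ s] := is_form_insertion U X a oU sX fa.
exact: (s c ac [::]).
Qed.

Lemma smooth_vector_field_scaleV U (X : vector_field M) (f : M -> R) : open U ->
  smooth_vector_field U X -> smooth_fun U f -> (forall q, U q -> f q != 0) ->
  smooth_vector_field U (fun q => (f q)^-1 *: X q).
Proof.
move=> oU sX sf f0 c ac; have oc : open (chart_set c U) by exact: open_chart_set.
apply/smooth_onP => k; apply: Ck_rV => // j.
apply: (eq_Ck _ _ (fun x => (f (bwd c x))^-1 *
    (to_chart c (bwd c x) (X (bwd c x))) ord0 j : R^o)) => //.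
  by move=> x _; rewrite /to_chart linearZ mxE.
apply: CkM => //.
  by apply: CkV => //; [move=> x [_]; apply: f0|have /smooth_onP := sf c ac; apply].
by apply: Ck_coord => //; have /smooth_onP := sX c ac; apply.
Qed.

(** Seen in [c'], the field is the derivative along [v] of the transition from [c] to [c'], composed
    with the inverse transition. *)
Lemma smooth_coordinate_field c v : atlas c ->
  smooth_vector_field (cdom c) (fun q => of_chart c q v).
Proof.
move=> ac c' ac'; have oc : open (chart_set c' (cdom c)).
  by apply: open_chart_set; exact: cdom_open.
have oc' : open (chart_set c (cdom c')).
  by apply: open_chart_set; exact: cdom_open.
apply/smooth_onP => k; apply: Ck_rV => // j.
have /smooth_onP C := atlas_compatible ac ac'.
have /smooth_onP C' := atlas_compatible ac' ac.
(* Order [k.+1], because one derivative is spent in forming the field. *)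
have [_ /(_ v) Dv] := C k.+1.
apply: (eq_Ck _ _ ((fun y => ('D_v (fwd c' \o bwd c) y) ord0 j : R^o) \o
                   (fwd c \o bwd c'))) => //.
  move=> x [c'x cx]; have c'b := bwd_dom c'x; set q := bwd c' x in cx c'b *.
  have d : differentiable (fwd c' \o bwd c) (fwd c q) by exact: transition_diff.
  have T := diff_transition_comp c (chart_at q) c' q v ac (chart_at_atlas q) ac'
    cx (chart_at_dom q) c'b.
  exact: (congr1 (fun u : V => u ord0 j) (etrans (deriveE v d) (esym T))).
apply: (@Ck_comp R m V k _ (chart_set c (cdom c')) (fwd c \o bwd c') _ oc oc' _ (C' k)).
  by move=> x [c'x cx]; exact: (chart_set_fwd c _ (bwd c' x) cx (bwd_dom c'x)).
exact: Ck_coord Dv.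
Qed.

Lemma smooth_fun_neq0_open U (f : M -> R) : open U -> smooth_fun U f ->
  open [set q | U q /\ f q != 0].
Proof.
move=> oU sf; rewrite openE => q [Uq fq].
have cq := chart_at_dom q; set c := chart_at q in cq.
have fc : {for q, continuous ((f \o bwd c) \o fwd c)}.
  apply: continuous_comp; first exact: fwd_continuous.
  apply: differentiable_continuous.
  by apply: (sf c (chart_at_atlas q) [::]); exact: chart_set_fwd.
have : \forall q' \near q, ((f \o bwd c) \o fwd c) q' != 0.
  apply: (fc [set y | y != 0]); apply: open_nbhs_nbhs; split; first exact: open_neq.
  by rewrite /= fwdK.
have := open_nbhs_nbhs (conj (@cdom_open _ _ _ c) cq).
have := open_nbhs_nbhs (conj oU Uq).
by apply: filterS3 => q' Uq' cq'; rewrite /= fwdK.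
Qed.

(** The coefficients differentiated in [extd] have the wrong number of arguments, so they vanish
    identically near the point. *)
Lemma extd_size k U (a : diff_form M) q s : open U -> is_kform k U a -> U q ->
  size s != k.+1 -> extd a q s = 0.
Proof.
move=> oU [_ ka] Uq sk; rewrite /extd big1// => i _.
rewrite (@near_eq_derive _ _ _ _ (cst 0)) ?derive_cst ?mulr0//.
apply: filterS (near_chart (chart_at q) U q oU (chart_at_dom q) Uq) => x [_ Ux].
apply: ka => //; rewrite size_map size_cat size_take size_drop ltn_ord.
apply: contra_neq sk => <-; by rewrite -addSn subnKC.
Qed.

Lemma is_form_scalar U (t : R) : open U ->
  is_form U (fun=> fun s => if s is [::] then t else 0 : R).
Proof.
move=> oU; split=> [p _|c ac s].
  split=> [s1 s2 r x y|s1 s2 s3 x]; last by case: s1.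
  by case: s1 => [|? ?]; rewrite /= mulr0 addr0.
have oc : open (chart_set c U) by exact: open_chart_set.
by apply/smooth_onP => k; case: s => [|v s]; exact: Ck_cst.
Qed.

(** [omega'] lies in its own ideal, hence in that of [omega]. The coefficient forms may be
    inhomogeneous, but on [n] arguments the one of [omega] enters only through its degree 0 part,
    which is [mu]. The other terms vanish since all shuffled arguments come from [s]. *)
Lemma monge_ampere_coef U n (theta omega omega' : diff_form M) :
  open U -> is_kform 1 U theta -> is_kform n U omega -> is_kform n U omega' ->
  monge_ampere U theta omega = monge_ampere U theta omega' ->
  exists2 mu : M -> R, smooth_fun U mu &
    forall q s, U q -> size s = n -> {in s, forall u, theta q [:: u] = 0} ->
      {in s &, forall u v, extd theta q [:: u; v] = 0} ->
      omega' q s = mu q * omega q s.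
Proof.
move=> oU kth ko ko' E.
have : monge_ampere U theta omega omega'.
  rewrite E; split; first by have [] := ko'.
  (* The coefficients are the constants 0, 0, 1, as 0-forms; index 2 is the position of [omega']
     among the generators. *)
  exists (fun i _ s => if s is [::] then (i == 2)%:R else 0); split.
    by move=> i; exact: is_form_scalar.
  move=> q Uq s; rewrite /= !big_ord_recl big_ord0 /= addr0.
  rewrite -![form_wedge _ _ q s]/(wedge _ _ s).
  have w0 a : wedge a (fun s : seq V => if s is [::] then 0 : R else 0) s = 0.
    by rewrite /wedge big1// => b _; case: (mask (map _ _) _); rewrite mulr0.
  rewrite !w0 !add0r.
  case: (eqVneq (size s) n) => sn; last first.
    rewrite (proj2 ko')//; symmetry; apply: (wedge_size n 0); last by rewrite addn0.
      by move=> x; exact: (proj2 ko').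
    by case.
  by rewrite (wedge_scalar_r n) ?mulr1//; exact: (proj2 ko').
move=> [_ [a [fa Ea]]]; exists (fun q => a 2%N q [::]).
  by move=> c ac; have [_ sa] := fa 2%N; exact: (sa c ac [::]).
move=> q s Uq sn th0 dth0; rewrite Ea// !big_ord_recl big_ord0 /= addr0.
rewrite -![form_wedge _ _ q s]/(wedge _ _ s).
rewrite wedge0l ?add0r; last first.
  move=> b; case: (eqVneq (size (mask b s)) 1%N) => [|/(proj2 kth _ Uq)//].
  have : {subset mask b s <= s} by move=> u; exact: mem_mask.
  by case: mask => [|u []]// sub _; rewrite th0// sub// mem_head.
rewrite wedge0l ?add0r; last first.
  move=> b; case: (eqVneq (size (mask b s)) 2%N) => [|/(extd_size 1 U)->//].
  have : {subset mask b s <= s} by move=> u; exact: mem_mask.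
  by case: mask => [|u [|v []]]// sub _; rewrite dth0// sub// !inE eqxx ?orbT.
by rewrite (wedge_scalar_r n) 1?mulrC//; exact: (proj2 ko).
Qed.

End ManifoldForms.

(** * Proportionality on the contact distribution, and the theorem *)

(** On [F1 + F2] the forms [a1], [b1] depend only on the [F1]-components of their arguments, and
    [a2], [b2] only on the [F2]-components. *)
Lemma bidecomposed_proportional (R : realType) (m : nat) (F1 F2 : {vspace 'rV[R]_m})
    (a1 a2 b1 b2 : seq 'rV[R]_m -> R) (t : R) :
  multilinear a1 -> Defs.alternating a1 -> multilinear a2 -> Defs.alternating a2 ->
  multilinear b1 -> Defs.alternating b1 -> multilinear b2 -> Defs.alternating b2 ->
  (forall u s, u \in F2 -> a1 (u :: s) = 0) ->
  (forall u s, u \in F1 -> a2 (u :: s) = 0) ->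
  (forall u s, u \in F2 -> b1 (u :: s) = 0) ->
  (forall u s, u \in F1 -> b2 (u :: s) = 0) ->
  (forall s, all (fun u => u \in F1) s -> b1 s = t * a1 s) ->
  (forall s, all (fun u => u \in F2) s -> b2 s = t * a2 s) ->
  forall s, {in s, forall u, u \in (F1 + F2)%VS} -> b1 s - b2 s = t * (a1 s - a2 s).
Proof.
move=> a1m a1a a2m a2a b1m b1a b2m b2a a1F a2F b1F b2F E1 E2 s sF.
pose f1 := addv_pi1 F1 F2; pose f2 := addv_pi2 F1 F2.
have K1 : {in s, forall u, u - f1 u \in F2}.
  by move=> u /sF uF; rewrite -{1}(addv_pi1_pi2 uF) addrC addKr memv_pi2.
have K2 : {in s, forall u, u - f2 u \in F1}.
  by move=> u /sF uF; rewrite -{1}(addv_pi1_pi2 uF) addrK memv_pi1.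
rewrite -(alternating_map_mod b1 (fun u => u \in F2) f1)//.
rewrite -(alternating_map_mod b2 (fun u => u \in F1) f2)//.
rewrite -(alternating_map_mod a1 (fun u => u \in F2) f1)//.
rewrite -(alternating_map_mod a2 (fun u => u \in F1) f2)//.
rewrite E1 ?E2 ?mulrBr//; apply/allP => _ /mapP[u _ ->].
  by rewrite memv_pi2.
by rewrite memv_pi1.
Qed.

Lemma is_kform_bidecomposable (R : realType) (m n : nat) (M : smooth_manifold R m)
    (E1 E2 : plane_field M) (omega1 omega2 omega : diff_form M) (U : set M) :
  bidecomposing n E1 E2 omega1 omega2 ->
  (forall p s, omega p s = omega1 p s - omega2 p s) -> is_kform n U omega.
Proof.
move=> [[f1 k1] [f2 k2] _ _ _] E; apply: (is_kform_sub n setT) => //.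
have -> : omega = fun p s => omega1 p s - cst 1 p * omega2 p s.
  by apply/funext => p; apply/funext => s; rewrite E /cst mul1r.
split; first apply: is_form_subZ => //; first exact: openT.
  apply/smooth_funP => c ac k; apply: Ck_cst; exact/open_chart_set/openT.
by move=> p _ s sn; rewrite k1// k2// mulr0 subr0.
Qed.

Theorem theorem3p2 (R : realType) (n : nat) (n_gt0 : (0 < n)%N)
    (M : smooth_manifold R (2 * n).+1) (D E1 E2 : plane_field M)
    (U : set M) (theta omega omega' : diff_form M) :
  contact_structure n D ->
  open U -> contact_form D U theta ->
  lagrangian_pair n D E1 E2 ->
  bidecomposable n E1 E2 omega ->
  bidecomposable n E1 E2 omega' ->
  monge_ampere U theta omega = monge_ampere U theta omega' ->
  forall p : M, U p ->
  exists (W : set M) (mu : M -> R) (eta : diff_form M),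
    [/\ open W, W p & W `<=` U] /\
    [/\ smooth_fun W mu, forall q, W q -> mu q != 0,
        is_kform n.-1 W eta
      & forall q, W q -> forall s : seq 'rV[R]_((2 * n).+1),
          omega' q s = mu q * omega q s + form_wedge theta eta q s].
Proof.
move=> cD oU cth [sE1 sE2 iE1 iE2 ED] [w1 [w2 [bw Ew]]] [w1' [w2' [bw' Ew']]] EM p Up.
have [kth thD] := cth.
have kw : is_kform n U omega := is_kform_bidecomposable _ _ _ _ _ _ _ _ _ _ bw Ew.
have kw' : is_kform n U omega' := is_kform_bidecomposable _ _ _ _ _ _ _ _ _ _ bw' Ew'.
have [mu smu Emu] := monge_ampere_coef U n theta omega omega' oU kth kw kw' EM.
have [[[w1m k1] [w2m k2] a1F a2F _] [[w1m' k1'] [w2m' k2'] b1F b2F nz]] := (bw, bw').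
have sE1D q : {subset E1 q <= D q}.
  by have [<- _] := ED q; apply/subvP; exact: addvSl.
have sE2D q : {subset E2 q <= D q}.
  by have [<- _] := ED q; apply/subvP; exact: addvSr.
have th0 q u : U q -> u \in D q -> theta q [:: u] = 0.
  by move=> Uq uD; apply/(proj1 (thD q Uq)).
have EmuE (E : plane_field M) q s : isotropic D E -> {subset E q <= D q} -> U q ->
    {in s, forall u, u \in E q} -> size s = n -> omega' q s = mu q * omega q s.
  move=> iE sED Uq sE sn; apply: Emu => // [u /sE/sED|u v /sE uE /sE vE].
    exact: th0.
  exact: (iE U theta oU cth q Uq u v uE vE).
(* Here [n_gt0] enters: the list has a head, and a form killed by vectors of [E] in the first slot
   vanishes on it. *)
have headE (E : plane_field M) q s (a : seq 'rV[R]_(2 * n).+1 -> R) :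
    {in s, forall u, u \in E q} -> size s = n ->
    (forall u l, u \in E q -> a (u :: l) = 0) -> a s = 0.
  move=> sE sn; have : (0 < size s)%N by rewrite sn.
  case: s sE {sn} => // u l sE _.
  by apply; apply: sE; rewrite mem_head.
have P1 q s : U q -> all (fun u => u \in E1 q) s -> w1' q s = mu q * w1 q s.
  move=> Uq /allP sE; have [sn|sn] := eqVneq (size s) n; last first.
    by rewrite k1' // k1 // mulr0.
  have := EmuE E1 q s iE1 (sE1D q) Uq sE sn; rewrite Ew Ew'.
  rewrite (headE E1 q s (w2 q))// ?(headE E1 q s (w2' q))// ?subr0//.
    by move=> *; apply: b2F.
  by move=> *; apply: a2F.
have P2 q s : U q -> all (fun u => u \in E2 q) s -> w2' q s = mu q * w2 q s.
  move=> Uq /allP sE; have [sn|sn] := eqVneq (size s) n; last first.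
    by rewrite k2' // k2 // mulr0.
  have := EmuE E2 q s iE2 (sE2D q) Uq sE sn; rewrite Ew Ew'.
  rewrite (headE E2 q s (w1 q))// ?(headE E2 q s (w1' q))// ?sub0r ?mulrN//.
  - exact: oppr_inj.
  - by move=> *; apply: b1F.
  - by move=> *; apply: a1F.
have mu0 q : U q -> mu q != 0.
  move=> Uq; have [[s sE ws] _] := nz q.
  by apply: contra_neq ws => mu0; rewrite (P1 q)// mu0 mul0r.
pose sigma q s := omega' q s - mu q * omega q s.
have sigmaD q s : U q -> {in s, forall u, u \in D q} -> sigma q s = 0.
  move=> Uq sD; apply/eqP; rewrite /sigma subr_eq0 Ew Ew'; apply/eqP.
  have [[? ?] [? ?]] := (proj1 w1m q I, proj1 w2m q I).
  have [[? ?] [? ?]] := (proj1 w1m' q I, proj1 w2m' q I).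
  apply: (bidecomposed_proportional _ _ (E1 q) (E2 q)) => //.
  - by move=> ? ?; apply: a1F.
  - by move=> ? ?; apply: a2F.
  - by move=> ? ?; apply: b1F.
  - by move=> ? ?; apply: b2F.
  - by move=> s'; apply: P1.
  - by move=> s'; apply: P2.
  - by have [-> _] := ED q.
(* If [theta p] were zero on all vectors, [D p] would be the whole tangent space, of dimension
   [(2 * n).+1] instead of [2 * n]. *)
have [v thv] : exists v, theta p [:: v] != 0.
  apply/not_existsP => th0p; have [[dD _] _] := cD.
  have Dp : D p = fullv.
    apply/vspaceP => u; rewrite memvf; apply/(proj1 (thD p Up)).
    by apply/eqP/negPn/negP; exact: th0p.
  by have := dD p; rewrite Dp dimvf dim_matrix mul1r => /esym/n_Sn.
set c0 := chart_at p; have ac0 : atlas c0 := chart_at_atlas p.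
(* [X] extends [v] with constant coordinates in the chart [c0]; at [p] it equals [v], since tangent
   vectors there are expressed in [c0] itself. *)
pose X q := of_chart c0 q v; pose U0 := U `&` cdom c0.
have oU0 : open U0 by apply: openI => //; exact: cdom_open.
have U0U : U0 `<=` U by move=> q [].
have sX : smooth_vector_field U0 X.
  by apply: smooth_vector_field_sub (smooth_coordinate_field c0 v ac0) => q [].
pose f q := theta q [:: X q].
have sf : smooth_fun U0 f.
  apply: smooth_contraction => //; exact: is_form_sub U0U (proj1 kth).
(* On this smaller neighbourhood [X] can be rescaled to [T] with [theta] equal to 1 on [T]. *)
pose W := [set q | U0 q /\ f q != 0].
have oW : open W by exact: smooth_fun_neq0_open.
have WU0 : W `<=` U0 by move=> q [].
have WU : W `<=` U by move=> q /WU0/U0U.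
pose T q := (f q)^-1 *: X q.
have sT : smooth_vector_field W T.
  apply: smooth_vector_field_scaleV => //; last by move=> q [].
    exact: smooth_vector_field_sub sX.
  exact: smooth_fun_sub sf.
have smuW : smooth_fun W mu by exact: smooth_fun_sub smu.
have ksigma : is_kform n W sigma.
  split.
    apply: is_form_subZ => //; first exact: is_form_sub (proj1 kw').
    exact: is_form_sub (proj1 kw).
  by move=> q Wq s sn; rewrite /sigma (proj2 kw')// ?(proj2 kw)// ?mulr0 ?subr0//;
  exact: WU.
exists W, mu, (fun q => insertion (T q) (sigma q)); split; split => //.
- split; first by split=> //; exact: chart_at_dom.
  by rewrite /f /X /of_chart diff_transition_id//; exact: chart_at_dom.
- by move=> q /WU/mu0.
- by apply: is_kform_insertion => //; rewrite prednK.
move=> q Wq s; have Uq := WU _ Wq; have [sm sa] := proj1 (proj1 ksigma) q Wq.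
have [thm _] := proj1 (proj1 kth) q Uq.
rewrite -[form_wedge _ _ q s]/(wedge (theta q) (insertion (T q) (sigma q)) s).
have thT : theta q [:: T q] = 1.
  by rewrite /T (multilinearZ _ thm [::]) mulVf//; have [] := Wq.
rewrite wedge_1form_insertion//; last by move=> l; exact: (proj2 kth).
(* The correction term evaluates [sigma] on the vectors [u - theta(u) T], which lie in the kernel
   [D q] of [theta]. *)
rewrite [X in _ - X]sigmaD//; first by rewrite subr0 /sigma addrC subrK.
move=> _ /mapP[u _ ->]; apply/(proj1 (thD q Uq)).
by rewrite addrC -scaleNr (thm [::]) thT mulr1 addNr.
Qed.
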